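(* Let $G$ be a $\sigma$-compact locally compact Abelian group. If $(\Omega,\alpha)$ is a point dynamical system on $G$, then the restriction $\delta|_\Omega:\Omega\to\delta(\Omega)$ of the map $\delta(\Lambda)=\sum_{x\in\Lambda}\delta_x$ to $\Omega$ establishes a topological conjugacy (a homeomorphism intertwining the $G$-actions) between the dynamical systems $(\Omega,\alpha)$ and $(\delta(\Omega),\alpha)$.
   Context: $\mathcal{C}(G)$ is the set of all closed subsets of $G$ with the local rubber topology (LRT): for $K\subset G$ compact and $V$ an open neighbourhood of $0$, set $U_{K,V}:=\{(P_1,P_2)\in\mathcal{C}(G)^2: P_1\cap K\subset P_2+V,\ P_2\cap K\subset P_1+V\}$; these generate a uniformity, and the LRT is the induced topology with neighbourhoods $U_{K,V}(P)=\{Q:(Q,P)\in U_{K,V}\}$. $G$ acts on $\mathcal{C}(G)$ by $\alpha_t(P)=t+P$. For an open neighbourhood $V$ of $0$, $\Lambda\subset G$ is $V$-discrete if every translate of $V$ contains at most one point of $\Lambda$; $\mathcal{D}_V(G)$ is the set of all $V$-discrete subsets of $G$ (they are closed). A point dynamical system $(\Omega,\alpha)$ is a closed (in the LRT), $\alpha$-invariant subset $\Omega\subset\mathcal{C}(G)$ with $\Omega\subset\mathcal{D}_V(G)$ for some open neighbourhood $V$ of $0$, together with the translation action. $\mathcal{M}(G)=C_c(G)^*$ is the space of complex Radon measures on $G$ with the vague (weak-$*$) topology, and $G$ acts on it by $\alpha_t\mu=\delta_t*\mu$, where $\delta_x$ is the unit point mass at $x$. $\delta(\Omega)\subset\mathcal{M}(G)$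 carries the vague topology and this action. *)

(* Defs.v *)
From HB Require Import structures.
From mathcomp Require Import all_boot all_order all_algebra.
From mathcomp Require Import finmap complex.
From mathcomp Require Import all_classical all_reals all_analysis.

Set Implicit Arguments.
Unset Strict Implicit.
Unset Printing Implicit Defensive.

Import Order.TTheory GRing.Theory Num.Theory.
Import numFieldNormedType.Exports.

Local Open Scope classical_set_scope.
Local Open Scope ring_scope.

HB.mixin Record isLCA G & TopologicalZmodule G := {
  lca_locally_compact : locally_compact [set: G];
  lca_hausdorff : hausdorff_space G
}.

#[short(type="lcaGroupType")]
HB.structure Definition LCAGroup := {G of TopologicalZmodule G & isLCA G}.

Definition sigma_compact (T : topologicalType) (A : set T) :=
  exists K : nat -> set T, (forall n, compact (K n)) /\ A = \bigcup_n K n.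

Definition minkowski (G : zmodType) (A B : set G) : set G :=
  [set a + b | a in A & b in B].

Section Closed_sets.
Variable G : lcaGroupType.

Record closedset := ClosedSet {
  closedset_set :> set G;
  closedsetP : closed closedset_set
}.

Lemma closedset_eq (P Q : closedset) : (P : set G) = Q -> P = Q.
Proof.
case: P Q => [P cP] [Q cQ] /= PQ; rewrite PQ in cP *.
by rewrite (Prop_irrelevance cP cQ).
Qed.

HB.instance Definition _ := gen_eqMixin closedset.
HB.instance Definition _ := gen_choiceMixin closedset.

Definition lrt_U (K V : set G) : set (closedset * closedset) :=
  [set PQ : closedset * closedset |
    (PQ.1 : set G) `&` K `<=` minkowski PQ.2 V /\
    (PQ.2 : set G) `&` K `<=` minkowski PQ.1 V].

Definition lrt_index : set (set G * set G) :=
  [set KV | compact KV.1 /\ open_nbhs 0 KV.2].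

(* The sets lrt_U K V are directed, so the uniformity that they generate is the
   filter of their supersets. *)
Definition lrt_entourage : set_system (closedset * closedset) :=
  filter_from lrt_index (fun KV => lrt_U KV.1 KV.2).

Lemma minkowskiS (A B C : set G) : B `<=` C -> minkowski A B `<=` minkowski A C.
Proof.
by move=> BC _ [a Aa [b Bb <-]]; exists a => //; exists b => //; exact: BC.
Qed.

Lemma lrt_entourage_filter : Filter lrt_entourage.
Proof.
apply: filter_from_filter.
  exists (set0, setT); split; first exact: compact0.
  by split; first exact: openT.
move=> [K V] [K' V'] /= [cK [oV V0]] [cK' [oV' V'0]].
exists (K `|` K', V `&` V').
  split; first exact: compactU.
  by split; [exact: openI|].
move=> [P Q] [/= PQ QP]; split; split=> x [Px Kx] /=.
- by apply: (minkowskiS (@subIsetl _ V V')); apply: PQ; split=> //; left.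
- by apply: (minkowskiS (@subIsetl _ V V')); apply: QP; split=> //; left.
- by apply: (minkowskiS (@subIsetr _ V V')); apply: PQ; split=> //; right.
- by apply: (minkowskiS (@subIsetr _ V V')); apply: QP; split=> //; right.
Qed.

Lemma lrt_entourage_refl A : lrt_entourage A -> diagonal `<=` A.
Proof.
move=> [[K V] [/= _ [_ V0]] UA] [P Q] /diagonalP PQ; apply: UA => /=.
rewrite PQ; split=> x [Qx _]; exists x => //; exists 0 => //; exact: addr0.
Qed.

Lemma lrt_entourage_inv A : lrt_entourage A -> lrt_entourage A^-1%relation.
Proof.
by move=> [KV iKV UA]; exists KV => // -[P Q] [PQ QP]; apply: UA.
Qed.

Lemma lrt_entourage_split A : lrt_entourage A ->
  exists2 B, lrt_entourage B & (B \; B `<=` A)%relation.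
Proof.
move=> [[K V] [/= cK [oV V0]] UA].
have [U U0 [cU _]] : compact_near (nbhs (0 : G)).
  have [U + h] := @lca_locally_compact G 0 I.
  by rewrite withinET => U0; exists U.
have : nbhs ((0, 0) : G * G) [set xy | V (xy.1 + xy.2)].
  apply: (@add_continuous G (0, 0)); rewrite /= addr0.
  exact: open_nbhs_nbhs.
move=> [[W1 W2] /= [nW1 nW2] WV].
have nW : nbhs (0 : G) (W1 `&` W2 `&` U) by apply: filterI => //; exact: filterI.
set W := interior (W1 `&` W2 `&` U).
have oW : open_nbhs 0 W by split; [exact: open_interior|exact: nW].
have WS : W `<=` W1 `&` W2 `&` U by exact: interior_subset.
set K' := (fun xy : G * G => xy.1 - xy.2) @` (K `*` U).
have cK' : compact K'.
  apply: continuous_compact; last exact: compact_setX.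
  by apply: continuous_subspaceT; exact: sub_continuous.
have step (P Q : closedset) x : lrt_U (K `|` K') W (P, Q) -> (P : set G) x -> K x ->
    exists2 y, (Q : set G) y & exists2 w, W w & K' y /\ x = y + w.
  move=> [/= PQ _] Px Kx; have [y Qy [w Ww yw]] := PQ x (conj Px (or_introl Kx)).
  exists y => //; exists w => //; split; last by rewrite yw.
  exists (x, w) => /=; last by rewrite -yw addrK.
  by split => //=; have [] := WS _ Ww.
exists (lrt_U (K `|` K') W).
  exists (K `|` K', W); last by move=> ?.
  split; [exact: (compactU cK cK')|exact: oW].
have sym (P Q : closedset) : lrt_U (K `|` K') W (P, Q) -> lrt_U (K `|` K') W (Q, P).
  by case.
have half (P Q S : closedset) : lrt_U (K `|` K') W (P, Q) ->
    lrt_U (K `|` K') W (Q, S) -> (P : set G) `&` K `<=` minkowski S V.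
  move=> PQ [/= QS _] x [Px Kx].
  have [y Qy [w Ww [K'y ->]]] := step _ _ _ PQ Px Kx.
  have [z Sz [w' Ww' <-]] := QS y (conj Qy (or_intror K'y)).
  exists z => //; exists (w' + w); last by rewrite addrA.
  have [[? ?] _] := WS _ Ww; have [[? ?] _] := WS _ Ww'.
  by apply: (WV (w', w)).
move=> [P S] [Q PQ QS]; apply: UA; split => /=.
  exact: half PQ QS.
by apply: half (sym _ _ QS) (sym _ _ PQ).
Qed.

HB.instance Definition _ := isUniform.Build closedset lrt_entourage_filter
  lrt_entourage_refl lrt_entourage_inv lrt_entourage_split.

Lemma addr_continuous (t : G) : continuous (fun x => x + t).
Proof.
move=> x; apply: (@continuous_comp _ _ _ (fun x : G => (x, t))
  (fun xy : G * G => xy.1 + xy.2)); last exact: add_continuous.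
by apply: cvg_pair; [exact: cvg_id|exact: cvg_cst].
Qed.

Lemma translate_preimage (t : G) (P : set G) :
  [set t + x | x in P] = (fun x => x - t) @^-1` P.
Proof.
apply/seteqP; split=> [_ [x Px <-]|x Px] /=; first by rewrite addrC addKr.
by exists (x - t) => //; rewrite addrC subrK.
Qed.

Lemma translate_closed (t : G) (P : set G) : closed P -> closed [set t + x | x in P].
Proof.
by rewrite translate_preimage; apply: preimage_closed => x _; exact: addr_continuous.
Qed.

Definition closedset_translate (t : G) (P : closedset) : closedset :=
  ClosedSet (@translate_closed t P (@closedsetP P)).

Definition discrete_for (V : set G) (P : set G) :=
  forall t, is_subset1 (P `&` [set t + v | v in V]).

Definition locally_finite (P : set G) :=
  forall K, compact K -> finite_set (P `&` K).

Lemma discrete_for_locally_finite (V P : set G) :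
  open_nbhs 0 V -> discrete_for V P -> locally_finite P.
Proof.
move=> [oV V0] dP K cK.
pose G' : ptopologicalType := HB.pack (G : Type) G (isPointed.Build G 0).
have {}cK : @cover_compact G' K by rewrite -compact_cover.
have oS (t : G) : open [set t + v | v in V].
  rewrite translate_preimage; apply: open_comp => // x _.
  exact: addr_continuous.
have [|D _ KD] := cK G setT (fun t => [set t + v | v in V]) (fun t _ => oS t).
  by move=> x _; exists x => //; exists 0 => //; rewrite addr0.
have PKD : P `&` K `<=` \bigcup_(t in [set` D]) (P `&` [set t + v | v in V]).
  by move=> x [Px /KD [t Dt tx]]; exists t.
apply: (sub_finite_set PKD).
apply: bigcup_finite => // t _.
have := dP t; set S := _ `&` _ => sS.
have [->|/set0P[x Sx]] := eqVneq S set0; first exact: finite_set0.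
by apply: (@sub_finite_set _ _ [set x]) => // y Sy; exact: sS.
Qed.

End Closed_sets.

(* R[i] as a numFieldType, the form for which the library provides the topology
   of the complex plane. *)
Definition complexField (R : realType) : numFieldType := R[i].

Section Measures.
Variables (R : realType) (G : lcaGroupType).
Local Notation C := (complexField R).

Definition tsupport (f : G -> C^o) : set G := closure [set x | f x != 0].

Definition Cc : {pred G -> C^o} :=
  mem [set f : G -> C^o | continuous f /\ compact (tsupport f)].

Lemma tsupport_compactS (f : G -> C^o) (K : set G) :
  compact K -> (forall x, f x != 0 -> K x) -> compact (tsupport f).
Proof.
move=> cK fK; apply: (subclosed_compact _ cK); first exact: closed_closure.
have /closure_id -> : closed K by apply: compact_closed => //; exact: lca_hausdorff.
by apply: closureS.
Qed.

Lemma Cc_submod_closed : submod_closed Cc.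
Proof.
split.
  apply/mem_set; split; first by move=> x; exact: cvg_cst.
  by apply: (@tsupport_compactS _ set0); [exact: compact0|move=> x; rewrite eqxx].
move=> a f g /set_mem[fc fs] /set_mem[gc gs]; apply/mem_set; split.
  move=> x; apply: (@cvgD C C^o); last exact: gc.
  by apply: (@cvgZl_tmp C C^o); exact: fc.
apply: (tsupport_compactS (compactU fs gs)) => x fg0.
have [f0|f0] := eqVneq (f x) 0; [right|by left; apply: subset_closure].
apply: subset_closure => /=; apply: contra_neq fg0 => g0.
by rewrite !fctE f0 g0 scaler0 addr0.
Qed.

HB.instance Definition _ :=
  GRing.isSubmodClosed.Build _ _ Cc Cc_submod_closed.

Record CcType := CcFun { Cc_fun :> G -> C^o; CcP : Cc_fun \in Cc }.

HB.instance Definition _ := [isSub for Cc_fun].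
HB.instance Definition _ := [Choice of CcType by <:].
HB.instance Definition _ := [SubChoice_isSubLmodule of CcType by <:].

(* Radon measures as continuous linear forms on the inductive limit of the
   Banach spaces of continuous functions supported in a fixed compact set:
   continuity means a sup-norm bound on each of these spaces. *)
Definition Radon_bounded (mu : CcType -> C^o) :=
  forall K : set G, compact K -> exists M : C, forall (f : CcType) (B : C),
    tsupport f `<=` K -> (forall x, `|f x| <= B) -> `|mu f| <= M * B.

Record Radon := MkRadon {
  Radon_fun :> {linear CcType -> C^o};
  RadonP : Radon_bounded Radon_fun
}.

HB.instance Definition _ := gen_eqMixin Radon.
HB.instance Definition _ := gen_choiceMixin Radon.
(* Vague topology: pointwise convergence on C_c(G). *)
HB.instance Definition _ := Topological.copy Radon
  (initial_topology (fun mu : Radon => (mu : CcType -> C^o) : {ptws CcType -> C^o})).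

Lemma Cc_translate_subproof (t : G) (f : CcType) :
  (fun x => f (t + x)) \in Cc.
Proof.
have /set_mem[fc fs] := CcP f.
have tc : continuous (fun x : G => t + x).
  have -> : (fun x : G => t + x) = (fun x => x + t) by apply/funext => x; rewrite addrC.
  exact: addr_continuous.
apply/mem_set; split=> [x|].
  by apply: (@continuous_comp _ _ _ (fun x : G => t + x) f); [exact: tc|exact: fc].
apply: (@tsupport_compactS _ ((fun x => x - t) @` tsupport f)).
  apply: continuous_compact => //.
  by apply: continuous_subspaceT; exact: addr_continuous.
move=> x fx; exists (t + x); last by rewrite addrC addKr.
exact: subset_closure.
Qed.

Definition Cc_translate (t : G) (f : CcType) : CcType :=
  CcFun (Cc_translate_subproof t f).

Lemma Cc_eq (f g : CcType) : (forall x, f x = g x) -> f = g.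
Proof. by move=> fg; apply: val_inj; apply/funext. Qed.

Definition dirac_form (x : G) (f : CcType) : C^o := f x.

Lemma dirac_form_linear x : linear (dirac_form x).
Proof. by []. Qed.

HB.instance Definition _ x := GRing.isLinear.Build C CcType C^o *:%R
  (dirac_form x) (dirac_form_linear x).

Lemma dirac_form_bounded x : Radon_bounded (dirac_form x).
Proof. by move=> K _; exists 1 => f B _ fB; rewrite mul1r; exact: fB. Qed.

Definition pointmass (x : G) : Radon := MkRadon (dirac_form_bounded x).

(* (delta_t * mu)(f) = \int \int f (x + y) d(delta_t)(x) dmu(y)
                     = \int f (t + y) dmu(y). *)
Definition translate_form (t : G) (mu : Radon) (f : CcType) : C^o :=
  mu (Cc_translate t f).

Lemma translate_form_linear t mu : linear (translate_form t mu).
Proof.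
move=> a f g; rewrite /translate_form -linearP; congr (mu _).
exact: Cc_eq.
Qed.

HB.instance Definition _ t mu := GRing.isLinear.Build C CcType C^o *:%R
  (translate_form t mu) (translate_form_linear t mu).

Lemma translate_form_bounded t mu : Radon_bounded (translate_form t mu).
Proof.
move=> K cK; have cK' : compact ((fun x => x - t) @` K).
  apply: continuous_compact => //.
  by apply: continuous_subspaceT; exact: addr_continuous.
have [M HM] := RadonP mu cK'; exists M => f B fK fB.
apply: HM; last by move=> x; exact: fB.
have /closure_id -> : closed ((fun x => x - t) @` K).
  by apply: compact_closed => //; exact: lca_hausdorff.
apply: closureS => x fx; exists (t + x); last by rewrite addrC addKr.
by apply: fK; apply: subset_closure.
Qed.

Definition Radon_translate (t : G) (mu : Radon) : Radon :=
  MkRadon (translate_form_bounded t mu).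

Lemma Radon_translate_convolution t mu (f g : CcType) :
  (forall y, g y = pointmass t (Cc_translate y f)) ->
  Radon_translate t mu f = mu g.
Proof.
move=> gE; rewrite /= /translate_form; congr (mu _); apply: Cc_eq => y.
by rewrite gE /= /dirac_form /= addrC.
Qed.

(* The sum is finite: f has compact support and P is locally finite. *)
Definition dirac_comb_form (P : set G) (_ : locally_finite P) (f : CcType) :
    C^o :=
  \sum_(x \in P) pointmass x f.

Lemma Cc_out (f : CcType) (K : set G) x : tsupport f `<=` K -> ~ K x -> f x = 0.
Proof.
move=> fK Kx; apply: contra_notP Kx => /eqP fx; apply: fK.
exact: subset_closure.
Qed.

Lemma dirac_comb_formE P (h : locally_finite P) (f : CcType) (K : set G) :
  tsupport f `<=` K -> dirac_comb_form h f = \sum_(x \in P `&` K) f x.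
Proof.
move=> fK; apply/esym/fsbig_widen; first exact: subIsetl.
by move=> x [Px /not_andP[//|Kx]] /=; exact: Cc_out fK Kx.
Qed.

Lemma dirac_comb_linear P (h : locally_finite P) : linear (dirac_comb_form h).
Proof.
move=> a f g; pose K := tsupport f `|` tsupport g.
have [/set_mem[_ fs] /set_mem[_ gs]] := (CcP f, CcP g).
have cK : compact K by exact: compactU.
have afgK : tsupport (a *: f + g) `<=` K.
  have /closure_id -> : closed K by apply: compact_closed => //; exact: lca_hausdorff.
  apply: closureS => x /= fg0.
  have [f0|f0] := eqVneq (f x) 0; [right|by left; apply: subset_closure].
  apply: subset_closure => /=; apply: contra_neq fg0 => g0.
  by rewrite -[LHS]/(a *: f x + g x) f0 g0 scaler0 addr0.
rewrite (dirac_comb_formE h afgK) (@dirac_comb_formE P h f K) ?(@dirac_comb_formE P h g K);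
  [|exact: subsetUr|exact: subsetUl].
rewrite !fsbig_finite; [|exact: h..].
by rewrite scaler_sumr -big_split.
Qed.

HB.instance Definition _ P (h : locally_finite P) :=
  GRing.isLinear.Build C CcType C^o *:%R (dirac_comb_form h) (dirac_comb_linear h).

Lemma dirac_comb_bounded P (h : locally_finite P) : Radon_bounded (dirac_comb_form h).
Proof.
move=> K cK; exists (size (fset_set (P `&` K)))%:R => f B fK fB.
rewrite (dirac_comb_formE h fK) fsbig_finite; last exact: h.
apply: (le_trans (ler_norm_sum _ _ _)).
rewrite -sum1_size natr_sum mulr_suml; apply: ler_sum => x _.
by rewrite mul1r; exact: fB.
Qed.

Definition dirac_comb P (h : locally_finite P) : Radon :=
  MkRadon (dirac_comb_bounded h).

Lemma zero_bounded : Radon_bounded (\0 : {linear CcType -> C^o}).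
Proof. by move=> K _; exists 0 => f B _ _; rewrite normr0 mul0r. Qed.

(* The zero measure is a dummy value for sets that are not locally finite;
   deltaE gives the value on uniformly discrete sets. *)
Definition delta (P : closedset G) : Radon :=
  if pselect (locally_finite P) is left h then dirac_comb h
  else MkRadon zero_bounded.

Lemma deltaE (V : set G) (P : closedset G) (f : CcType) :
  open_nbhs 0 V -> discrete_for V P -> delta P f = \sum_(x \in P) pointmass x f.
Proof.
move=> V0 VP; rewrite /delta; case: pselect => // -[].
exact: discrete_for_locally_finite V0 VP.
Qed.

End Measures.

Section Dynamical_systems.

Definition invariant_set (G X : Type) (a : G -> X -> X) (A : set X) :=
  forall t x, A x -> A (a t x).

Definition point_dynamical_system (G : lcaGroupType)
    (Omega : set (closedset G)) :=
  [/\ closed Omega,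
      invariant_set (@closedset_translate G) Omega &
      exists2 V : set G, open_nbhs 0 V & forall P, Omega P -> discrete_for V P].

(* A and B carry the subspace topologies; g is the inverse map B -> A, extended
   arbitrarily outside B. *)
Definition homeomorphism_on (X Y : topologicalType) (A : set X) (B : set Y)
    (f : X -> Y) :=
  [/\ set_bij A B f, {within A, continuous f} &
      exists2 g : Y -> X, {in A, cancel f g} & {within B, continuous g}].

Definition topological_conjugacy (G : Type) (X Y : topologicalType)
    (aX : G -> X -> X) (aY : G -> Y -> Y) (A : set X) (B : set Y)
    (f : X -> Y) :=
  [/\ invariant_set aX A, invariant_set aY B, homeomorphism_on A B f &
      forall t x, A x -> f (aX t x) = aY t (f x)].

End Dynamical_systems.

(* Main.v *)
(** If [f >= 0], then [delta P f] bounds from above every value of [f] on [P], and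
    [delta P f = 0] as soon as [f] vanishes on [P]. Bump functions, which exist
    because locally compact Hausdorff spaces are completely regular, therefore
    detect the points of [P]; this gives injectivity and the continuity of the
    inverse. Conversely, if [P] and [Q] are [V]-discrete and close in the local
    rubber topology, then the points of [P] in a compact neighbourhood of the
    support of [f] inject into [Q] by moving each of them a little, and the image
    contains every point of [Q] in the support. *)

Require Import Defs.
From HB Require Import structures.
From mathcomp Require Import all_boot all_order all_algebra.
From mathcomp Require Import finmap complex.
From mathcomp Require Import all_classical all_reals all_analysis.

Set Implicit Arguments.
Unset Strict Implicit.
Unset Printing Implicit Defensive.

Import Order.TTheory GRing.Theory Num.Theory.
Import numFieldNormedType.Exports.

Local Open Scope classical_set_scope.
Local Open Scope ring_scope.

(** * Bump functions with complex values *)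

Lemma real_complex_continuous (R : realType) :
  continuous (fun x : R => x%:C%C : complexField R).
Proof.
move=> x; apply/cvgrPdist_lt => e; rewrite ltcE /= => /andP[/eqP e0 e1].
near=> y.
(* A positive element of [R[i]] is real, so the estimate takes place in [R]. *)
have -> : e = (complex.Re e)%:C%C :> complexField R.
  by apply/eqP; rewrite eq_complex /= eqxx e0 /=.
rewrite -rmorphB normc_def /= expr0n addr0 sqrtr_sqr ltcR.
near: y; exact: cvgr_dist_lt.
Unshelve. all: by end_near. Qed.

Lemma lca_compact_nbhs (G : lcaGroupType) (x : G) :
  exists2 W, nbhs x W & compact W.
Proof.
have [W + [cW _]] := @lca_locally_compact G x I.
by rewrite withinET => xW; exists W.
Qed.

(** Complete regularity separates [x] from the complement of the interior of [U] intersected with a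
    compact neighbourhood [W], by a function that is 0 at [x] and 1 on that complement. One minus
    this function is the bump, and [W] makes its support compact. *)
Lemma locally_compact_bump (R : realType) (G : lcaGroupType) (x : G) (U : set G) :
  nbhs x U -> exists f : CcType R G,
    [/\ f x = 1, forall y, 0 <= f y & forall y, f y != 0 -> U y].
Proof.
move=> xU.
have [W xW cW] := lca_compact_nbhs x.
pose B := ~` interior (U `&` W).
have [f [fc f01 fx fB]] : exists f : G -> R, [/\ continuous f,
    range f `<=` `[0, 1], f @` [set x] `<=` [set 0] & f @` B `<=` [set 1]].
  apply/uniform_separatorP/(@locally_compact_completely_regular G R).
  - exact: lca_locally_compact.
  - exact: lca_hausdorff.
  - by apply: open_closedC; exact: open_interior.
  - by apply; apply: filterI.
have fE y : f y != 1 -> (U `&` W) y.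
  move=> fy1; apply: interior_subset; apply: contrapT => By.
  by move/eqP: fy1; apply; apply: fB; exists y.
pose g y : complexField R := (1 - f y)%:C%C.
have gE y : g y != 0 -> (U `&` W) y.
  by move=> gy; apply: fE; apply: contra_neq gy => fy; rewrite /g fy subrr.
have gCc : (g : G -> (complexField R)^o) \in @Cc R G.
  apply/mem_set; split.
    move=> y; apply: (@continuous_comp _ _ _ (fun y => 1 - f y)); last first.
      exact: real_complex_continuous.
    by apply: cvgB; [exact: cvg_cst|exact: fc].
  by apply: (tsupport_compactS cW) => y /gE[].
exists (CcFun gCc); split=> [|y|y /gE[]//].
- by rewrite /= /g (_ : f x = 0) ?subr0//; apply: fx; exists x.
- rewrite /= /g lecR subr_ge0.
  by have := f01 (f y) (ex_intro2 _ _ y I erefl); rewrite /= in_itv /= => /andP[].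
Qed.

(** * Values of [delta P] on test functions *)

Lemma delta_sum (R : realType) (G : lcaGroupType) (P : closedset G)
    (f : CcType R G) :
  locally_finite P -> delta R P f = \sum_(x \in P) (f x : complexField R).
Proof. by rewrite /delta; case: pselect. Qed.

Lemma delta_sum_compact (R : realType) (G : lcaGroupType) (P : closedset G)
    (f : CcType R G) (K : set G) :
  locally_finite P -> tsupport f `<=` K ->
  delta R P f = \sum_(x \in (P : set G) `&` K) (f x : complexField R).
Proof.
move=> lP fK; rewrite delta_sum//; apply/esym/fsbig_widen; first exact: subIsetl.
by move=> x [Px /not_andP[//|Kx]] /=; exact: Cc_out fK Kx.
Qed.

Lemma le_delta (R : realType) (G : lcaGroupType) (P : closedset G)
    (f : CcType R G) (x : G) :
  locally_finite P -> (forall y, 0 <= f y) -> (P : set G) x ->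
  f x <= delta R P f.
Proof.
move=> lP f0 Px; have /set_mem[_ cf] := CcP f.
(* The point [x] may lie outside the support of [f]; adjoining it makes it an index of the finite
   sum. *)
have cxf : compact (x |` tsupport f) by apply: compactU => //; exact: compact_set1.
rewrite (delta_sum_compact lP (@subsetUr _ [set x] (tsupport f))).
rewrite (fsbigD1 x) /=; [|exact: lP|by split=> //; left].
by rewrite lerDl; apply: fsumr_ge0 => y _; exact: f0.
Qed.

Lemma delta_neq0 (R : realType) (G : lcaGroupType) (P : closedset G)
    (f : CcType R G) :
  locally_finite P -> delta R P f != 0 ->
  exists2 x, (P : set G) x & f x != 0.
Proof.
move=> lP; apply: contra_neqP => nP; rewrite delta_sum//; apply: fsbig1 => x Px.
by apply: contra_notP nP => /eqP fx; exists x.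
Qed.

(** * Equality and vague convergence of Radon measures *)

Lemma Radon_eq (R : realType) (G : lcaGroupType) (mu nu : Radon R G) :
  (forall f, mu f = nu f) -> mu = nu.
Proof.
case: mu nu => [m mb] [n nb] /= mn.
have {}mn : (m : CcType R G -> (complexField R)^o) = n by apply/funext.
have mn' : m = n.
  case: m n mn {mb nb} => [m [[a] [b]]] [n [[a'] [b']]] /= mn; subst n.
  by rewrite (Prop_irrelevance a a') (Prop_irrelevance b b').
by subst n; rewrite (Prop_irrelevance mb nb).
Qed.

Lemma Radon_eval_continuous (R : realType) (G : lcaGroupType) (f : CcType R G) :
  continuous (fun mu : Radon R G => mu f).
Proof.
move=> mu; apply: (@continuous_comp _ _ _ (fun mu : Radon R G =>
  (mu : CcType R G -> (complexField R)^o) : {ptws CcType R G -> (complexField R)^o})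
  (fun g => g f)); first exact: initial_continuous.
exact: (@proj_continuous (CcType R G) (fun=> (complexField R)^o) f).
Qed.

(** The vague topology is initial for the map into a product, whose convergence is tested coordinate
    by coordinate. *)
Lemma cvg_Radon (R : realType) (G : lcaGroupType) (T : Type) (F : set_system T)
    (h : T -> Radon R G) (mu : Radon R G) :
  Filter F -> (forall f, (fun t => h t f) @ F --> mu f) -> h @ F --> mu.
Proof.
move=> FF hmu A [_ [[B oB <-] Bmu BA]].
have h_cvg : (fun t => h t : CcType R G -> (complexField R)^o) @ F -->
    ((mu : CcType R G -> (complexField R)^o) : {ptws CcType R G -> (complexField R)^o}).
  apply/cvg_sup => f C [_ [[D oD <-] Dmu DC]].
  have /(hmu f) : nbhs (mu f) D by apply: open_nbhs_nbhs.
  by apply: (@filterS _ F FF (fun t => D (h t f))) => t; exact: DC.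
have : nbhs ((mu : CcType R G -> (complexField R)^o) :
  {ptws CcType R G -> (complexField R)^o}) B by apply: open_nbhs_nbhs.
by move=> /h_cvg; apply: (@filterS _ F FF (fun t => B (h t))) => t; exact: BA.
Qed.

(** * Equivariance and injectivity of [delta] *)

Lemma delta_translate (R : realType) (G : lcaGroupType) (t : G) (P : closedset G) :
  locally_finite P -> locally_finite (closedset_translate t P) ->
  delta R (closedset_translate t P) = Radon_translate t (delta R P).
Proof.
move=> lP ltP; apply: Radon_eq => f; rewrite delta_sum//=.
rewrite /translate_form delta_sum//.
exact: fsbig_image (fun x y _ _ => @addrI _ t x y).
Qed.

(** A bump at a point of [P] outside the closed set [Q], supported off [Q], is given a positive
    value by [delta P] and the value 0 by [delta Q]. *)
Lemma delta_inj (R : realType) (G : lcaGroupType) (P Q : closedset G) :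
  locally_finite P -> locally_finite Q -> delta R P = delta R Q -> P = Q.
Proof.
wlog suff : P Q / locally_finite P -> locally_finite Q ->
    delta R P = delta R Q -> (P : set G) `<=` Q.
  move=> h lP lQ PQ; apply: closedset_eq; apply/seteqP; split; exact: h.
move=> lP lQ PQ x Px; apply: contrapT => Qx.
have [|f [fx f0 fQ]] := @locally_compact_bump R G x (~` (Q : set G)).
  by apply: open_nbhs_nbhs; split=> //; apply: closed_openC; exact: closedsetP.
have [|y Qy /fQ//] := delta_neq0 (R := R) (f := f) lQ.
rewrite -PQ gt_eqF//; apply: lt_le_trans (le_delta lP f0 Px).
by rewrite fx ltr01.
Qed.

(** * Neighbourhoods in the local rubber topology and continuity of [delta] *)

Lemma open_nbhs0_symmetric (G : topologicalZmodType) (U : set G) :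
  nbhs 0 U -> exists V, [/\ open_nbhs 0 V, V `<=` U & forall v, V v -> V (- v)].
Proof.
move=> U0; exists (interior U `&` -%R @^-1` interior U); split.
- split; last by split=> /=; rewrite ?oppr0; exact: U0.
  apply: openI; first exact: open_interior.
  by apply: open_comp; [move=> x _; exact: opp_continuous|exact: open_interior].
- by move=> x [/interior_subset].
- by move=> v [Uv Uv'] /=; rewrite /preimage /= opprK.
Qed.

Lemma near_lrt (G : lcaGroupType) (P : closedset G) (K V : set G) :
  compact K -> open_nbhs 0 V -> \forall Q \near P, lrt_U K V (P, Q).
Proof.
move=> cK V0; suff : nbhs P [set Q | lrt_U K V (P, Q)] by [].
rewrite -(@nbhs_entourageE (closedset G)).
by exists (lrt_U K V) => [|Q /xsectionP//]; exists (K, V).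
Qed.

Lemma nbhs_lrt (G : lcaGroupType) (P : closedset G) (A : set (closedset G)) :
  nbhs P A -> exists K V, [/\ compact K, open_nbhs 0 V &
    forall Q, lrt_U K V (P, Q) -> A Q].
Proof.
rewrite -(@nbhs_entourageE (closedset G)) => -[E [[K V] [cK V0] KVE] EA].
by exists K, V; split=> // Q PQ; apply: EA; apply/xsectionP; exact: KVE.
Qed.

Lemma delta_continuous (R : realType) (G : lcaGroupType) (V : set G)
    (Omega : set (closedset G)) :
  open_nbhs 0 V -> (forall P, Omega P -> discrete_for V P) ->
  {within Omega, continuous (@delta R G)}.
Proof.
move=> V0 OV; have Olf P : Omega P -> locally_finite P.
  by move=> /OV; exact: discrete_for_locally_finite.
apply/subspace_continuousP => P OP; apply: cvg_Radon => f.
apply/cvgrPdist_lt => e e0; have /set_mem[fc cf] := CcP f.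
have [W W0 cW] := @lca_compact_nbhs G 0.
(* Enlarging the support by [W] ensures that a point [x] of [P] with [x + v] in the support and [v]
   in [W] lies in [K]. *)
pose K := (fun xy : G * G => xy.1 - xy.2) @` (tsupport f `*` W).
have cK : compact K.
  apply: continuous_compact; last exact: compact_setX.
  by apply: continuous_subspaceT; exact: sub_continuous.
have fK : tsupport f `<=` K.
  by move=> x fx; exists (x, 0); [split=> //; exact: nbhs_singleton|rewrite /= subr0].
pose F := (P : set G) `&` K; have finF : finite_set F by exact: (Olf P OP).
pose n := size (fset_set F).
(* The final bound is [n] times this quantity; dividing by [n.+1] keeps it strictly below [e] and
   covers an empty [F]. *)
have en0 : 0 < e / n.+1%:R by rewrite divr_gt0.
(* As [V'] is contained in [V], the translate [x + V'] of a point [x] of [F]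
   contains at most one point of [Q]; it is the value [phi x] below. *)
have [V' [V'0 V'VW V'N]] : exists V', [/\ open_nbhs 0 V', V' `<=`
    V `&` W `&` \bigcap_(x in [set` fset_set F])
      [set v | `|f x - f (x + v)| < e / n.+1%:R] &
    forall v, V' v -> V' (- v)].
  apply: open_nbhs0_symmetric; apply: filterI.
    by apply: filterI => //; exact: open_nbhs_nbhs.
  apply: filter_bigI => x _.
  have : (fun v => f (x + v)) @ 0 --> f x.
    rewrite -[in f x](addr0 x); apply: continuous_comp; last exact: fc.
    rewrite (_ : +%R x = fun v => v + x); first exact: addr_continuous.
    by apply/funext => v; rewrite addrC.
  by move=> /cvgrPdist_lt; exact.
rewrite near_withinE; near=> Q => OQ.
have [PQ QP] : lrt_U K V' (P, Q) by near: Q; exact: near_lrt.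
have [phi phiP] : {phi : G -> G & forall x, F x ->
    (Q : set G) (phi x) /\ V' (phi x - x)}.
  apply: (@choice _ _ (fun x y => F x -> (Q : set G) y /\ V' (y - x))) => x.
  have [Fx|nFx] := pselect (F x); last by exists 0.
  have [y Qy [v Vv yv]] := PQ x Fx; exists y => _; split=> //.
  by rewrite -yv opprD addNKr; exact: V'N.
have VV' : V' `<=` V by move=> v /V'VW[[]].
(* By symmetry of [V'], two points of [P] with the same image lie in one translate of [V] around
   that image, so they coincide. *)
have phi_inj : set_inj F phi.
  move=> x y /set_mem Fx /set_mem Fy xy; apply: (OV P OP (phi x)); split.
  - by case: Fx.
  - exists (x - phi x); last by rewrite addrC subrK.
    by apply: VV'; rewrite -opprB; apply: V'N; case: (phiP _ Fx).
  - by case: Fy.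
  - exists (y - phi y); last by rewrite xy addrC subrK.
    by apply: VV'; rewrite -opprB; apply: V'N; case: (phiP _ Fy).
(* If [f y] is nonzero for some [y] in [Q], then [y] lies in [x + V'] for some [x] in [F]. So does
   [phi x], and [V]-discreteness of [Q] gives [y = phi x]. Hence [f] vanishes on the rest of [Q]. *)
have -> : delta R Q f = \sum_(x \in F) (f (phi x) : complexField R).
  rewrite delta_sum; last exact: Olf.
  rewrite -(@fsbig_image _ _ _ _ _ F phi (fun y => f y : complexField R) phi_inj).
  apply/esym/fsbig_widen; first by move=> _ [x Fx <-]; case: (phiP _ Fx).
  move=> y [Qy nFy] /=; apply: contra_notP nFy => /eqP fy.
  have sy : tsupport f y by exact: subset_closure.
  have [x Px [v Vv xv]] := QP y (conj Qy (fK y sy)).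
  have Fx : F x.
    split=> //; exists (y, v); first by split=> //; case: (V'VW _ Vv) => -[].
    by rewrite /= -xv addrK.
  exists x => //; have [Qphi Vphi] := phiP _ Fx.
  apply: (OV Q OQ x); split=> //; last by exists v => //; exact: VV'.
  by exists (phi x - x); [exact: VV'|rewrite addrC subrK].
rewrite (delta_sum_compact (Olf P OP) fK) -/F !fsbig_finite// -sumrB.
apply: (le_lt_trans (ler_norm_sum _ _ _)).
apply: (@le_lt_trans _ _ (\sum_(x <- fset_set F) (e / n.+1%:R))).
  rewrite big_seq [leRHS]big_seq; apply: ler_sum => x xF.
  have Fx : F x by move: xF; rewrite in_fset_set// => /set_mem.
  have [_ /V'VW[_ /(_ x xF)/=]] := phiP _ Fx.
  by rewrite [x + _]addrC subrK => /ltW.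
rewrite big_const_seq count_predT -/n iter_addr addr0.
by rewrite -[ltLHS]mulr_natr mulrAC ltr_pdivrMr// ltr_pM2l// ltr_nat.
Unshelve. all: by end_near. Qed.

(** * Continuity of the inverse *)

Lemma minkowski_open (G : lcaGroupType) (A B : set G) :
  open B -> open (Defs.minkowski A B).
Proof.
move=> oB; rewrite (_ : Defs.minkowski A B = \bigcup_(a in A) [set a + b | b in B]).
  apply: bigcup_open => a _; rewrite translate_preimage.
  by apply: open_comp => // x _; exact: addr_continuous.
apply/seteqP; split=> [_ [a Aa [b Bb <-]]|_ [a Aa [b Bb <-]]].
  by exists a => //; exists b.
by exists a => //; exists b.
Qed.

Lemma nbhs_translate (G : topologicalZmodType) (x : G) (U : set G) :
  nbhs 0 U -> nbhs x [set y | U (y - x)].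
Proof.
move=> U0; have : (fun y => y - x) @ x --> (0 : G).
  rewrite -(subrr x).
  apply: (@continuous_comp _ _ _ (fun y : G => (y, x)) (fun yz => yz.1 - yz.2)).
    by apply: cvg_pair; [exact: cvg_id|exact: cvg_cst].
  exact: sub_continuous.
exact.
Qed.

Lemma delta_inverse_cvg (R : realType) (G : lcaGroupType)
    (Omega : set (closedset G)) (g : Radon R G -> closedset G) (P : closedset G) :
  (forall Q, Omega Q -> locally_finite Q) ->
  {in Omega, cancel (@delta R G) g} -> Omega P ->
  g @ within (@delta R G @` Omega) (nbhs (delta R P)) --> P.
Proof.
move=> Olf gK OP A /nbhs_lrt[K [V [cK V0 KVA]]].
(* The inclusion of [g mu] intersected with [K] in [P + V] is restated as [g mu] missing the compact
   set [K] minus [P + V], so that both halves become local conditions on a compact set. *)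
suff [PQ QP] : (\forall mu \near within (@delta R G @` Omega) (nbhs (delta R P)),
      (P : set G) `&` K `<=` Defs.minkowski (g mu) V) /\
    (\forall mu \near within (@delta R G @` Omega) (nbhs (delta R P)),
      K `\` Defs.minkowski P V `<=` ~` (g mu : set G)).
  apply: filterS2 PQ QP => mu PQ QP; apply: KVA; split=> // x [Qx Kx] /=.
  by apply: contrapT => nPVx; apply: (QP x).
(* In each part one bump function controls [g mu] near one point; compactness of
   [P `&` K], respectively of [K `\` (P + V)], makes finitely many suffice. *)
split.
  have cPK : compact ((P : set G) `&` K).
    by rewrite setIC; apply: compact_closedI => //; exact: closedsetP.
  move/compact_near_coveringP : cPK; apply => x [Px Kx].
  have : nbhs ((0, 0) : G * G) [set xy | V (xy.1 - xy.2)].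
    by apply: (@sub_continuous G (0, 0)); rewrite /= subr0; exact: open_nbhs_nbhs.
  move=> [[W1 W2] /= [nW1 nW2] WV].
  have [f [fx f0 fW]] := @locally_compact_bump R G x _ (nbhs_translate x nW2).
  have Pf : delta R P f != 0.
    by rewrite gt_eqF// (lt_le_trans _ (le_delta (Olf _ OP) f0 Px))// fx ltr01.
  (* Keeping membership in the image allows writing [mu] as [delta Q], so that [g mu] is [Q] and has
     a point [z] where [f] is nonzero, within [x + W2]. *)
  have near_f : \forall mu \near within (@delta R G @` Omega) (nbhs (delta R P)),
      (@delta R G @` Omega) mu /\ mu f != 0.
    rewrite near_withinE; near=> mu => Dmu; split=> //; near: mu.
    exact: cvgr_neq0 (@Radon_eval_continuous R G f (delta R P)) Pf.
  exists ([set y | W1 (y - x)], [set mu | (@delta R G @` Omega) mu /\ mu f != 0]).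
    by split; [exact: nbhs_translate|exact: near_f].
  move=> [y mu] /= [W1y [[Q OQ <-] Qf]]; rewrite gK ?inE//.
  have [z Qz /fW W2z] := delta_neq0 (Olf _ OQ) Qf.
  exists z => //; exists ((y - x) - (z - x)); first exact: (WV (y - x, z - x)).
  by rewrite opprB addrC addrA !subrK.
have cC : compact (K `\` Defs.minkowski P V).
  apply: compact_closedI => //; apply: open_closedC; apply: minkowski_open.
  by case: V0.
move/compact_near_coveringP : cC; apply => x [Kx nPVx].
have [|f [fx f0 fP]] := @locally_compact_bump R G x (~` (P : set G)).
  apply: open_nbhs_nbhs; split; first by apply: closed_openC; exact: closedsetP.
  by move=> Px; apply: nPVx; exists x => //; exists 0; [case: V0|rewrite addr0].
have Pf : delta R P f = 0.
  by apply/eqP/negP => /negP/(delta_neq0 (Olf _ OP))[y Py /fP].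
(* A point [y] of [Q] near [x] would satisfy [f y <= delta Q f < 1/2], while [f y] is within 1/2 of
   [f x = 1]; these bounds are incompatible. *)
have e0 : 0 < 2^-1 :> complexField R by rewrite invr_gt0.
have near_f : \forall mu \near within (@delta R G @` Omega) (nbhs (delta R P)),
    (@delta R G @` Omega) mu /\ `|delta R P f - mu f| < 2^-1.
  rewrite near_withinE; near=> mu => Dmu; split=> //; near: mu.
  by move/cvgrPdist_lt : (@Radon_eval_continuous R G f (delta R P)) => /(_ _ e0).
exists ([set y | `|f x - f y| < 2^-1],
    [set mu | (@delta R G @` Omega) mu /\ `|delta R P f - mu f| < 2^-1]).
  have /set_mem[fc _] := CcP f; split; last exact: near_f.
  by move/cvgrPdist_lt : (fc x) => /(_ _ e0).
move=> [y mu] /= [fy [[Q OQ <-] Qf]]; rewrite gK ?inE// => Qy.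
have fyQ := le_delta (Olf _ OQ) f0 Qy.
have : `|f x| < 2^-1 + 2^-1.
  rewrite -(subrK (f y) (f x)); apply: (le_lt_trans (ler_normD _ _)).
  apply: ltrD => //; apply: le_lt_trans Qf.
  by rewrite Pf sub0r normrN !ger0_norm//; apply: le_trans fyQ.
by rewrite -[2^-1]div1r -splitr fx normr1 ltxx.
Unshelve. all: by end_near. Qed.

Theorem theorem4 (R : realType) (G : lcaGroupType)
  (sG : sigma_compact [set: G])
  (Omega : set (closedset G)) (hOmega : point_dynamical_system Omega) :
  topological_conjugacy (@closedset_translate G) (@Radon_translate R G)
    Omega (@delta R G @` Omega) (@delta R G).
Proof.
case: hOmega => _ Oinv [V V0 OV].
have Olf P : Omega P -> locally_finite P.
  by move=> /OV; exact: discrete_for_locally_finite.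
have deltaT t P : Omega P ->
    delta R (closedset_translate t P) = Radon_translate t (delta R P).
  by move=> OP; apply: delta_translate; apply: Olf => //; exact: Oinv.
have inj : {in Omega &, injective (@delta R G)}.
  by move=> P Q /set_mem/Olf lP /set_mem/Olf lQ; exact: delta_inj.
split=> //.
  move=> t _ [P OP <-]; exists (closedset_translate t P); first exact: Oinv.
  exact: deltaT.
split; [exact: inj_bij|exact: delta_continuous V0 OV|].
(* On the image, [g] picks a preimage in [Omega], unique by injectivity; elsewhere it returns the
   empty set. *)
pose g mu := xget (ClosedSet closed0)
  [set P : closedset G | Omega P /\ delta R P = mu].
have gK : {in Omega, cancel (@delta R G) g}.
  move=> P OP; have [Og] := @xgetPex _ (ClosedSet closed0)
    [set Q : closedset G | Omega Q /\ delta R Q = delta R P]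
    (ex_intro _ P (conj (set_mem OP) erefl)).
  by apply: inj => //; exact: mem_set.
exists g => //; apply/subspace_continuousP => _ [P OP <-].
by rewrite /from_subspace gK ?inE//; exact: delta_inverse_cvg.
Qed.
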